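(* Let $\mathcal{D}(p)$ be a Boolean product distribution on $\{0,1\}^d$ and let $\mathcal{D}_S$ be any $\alpha$-fat truncation of $\mathcal{D}$. Then, for any $\varepsilon,\delta>0$, we can compute a Boolean product distribution $\hat{\mathcal{D}}(\hat p)$ such that $D_{TV}(\mathcal{D},\hat{\mathcal{D}})\le\varepsilon$, with probability at least $1-\delta$, using $O(d\log(d)\log(d/\delta)/(\varepsilon^2\alpha))$ samples from $\mathcal{D}_S$.
   Context: A Boolean product distribution with parameter vector $p=(p_1,\dots,p_d)$ is the product of $d$ independent Bernoulli distributions with parameters $p_i$. For $S\subseteq\{0,1\}^d$, the truncation $\mathcal{D}_S$ has $\mathcal{D}_S(x)=\mathcal{D}(x)/\mathcal{D}(S)$ for $x\in S$ and $0$ otherwise. $\mathrm{flip}(x,i)$ denotes $x$ with its $i$-th coordinate flipped. $\mathcal{D}_S$ is $\alpha$-fat, for some $\alpha>0$, if $\Pr_{x\sim\mathcal{D}_S}[\mathrm{flip}(x,i)\in S]\ge\alpha$ for every $i\in[d]$. $D_{TV}$ is total variation distance. ''We can compute'' means that there is an algorithm with access to independent samples from $\mathcal{D}_S$ and a membership oracle for $S$ achieving the stated guarantee. $O(\cdot)$ hides an absolute constant; as usual, logarithmic factors are read as at least a positive constant (relevant only for $d=1$ or $\delta$ close to $1$). *)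

(* Defs.v *)
From HB Require Import structures.
From mathcomp Require Import all_boot all_order all_algebra.
From mathcomp Require Import all_classical all_reals all_analysis.
Set Implicit Arguments.
Unset Strict Implicit.
Unset Printing Implicit Defensive.
Import Order.TTheory GRing.Theory Num.Theory.
Local Open Scope ring_scope.

Notation cube d := {ffun 'I_d -> bool}.

Section Distributions.
Context {R : realType}.

Definition Pr (T : finType) (mu : T -> R) (A : {set T}) : R :=
  \sum_(x in A) mu x.

Definition dTV (T : finType) (mu nu : T -> R) : R :=
  2^-1 * \sum_x `|mu x - nu x|.

Definition product_pmf d (p : 'I_d -> R) (x : cube d) : R :=
  \prod_i bernoulli_pmf (p i) (x i).

(* Identically 0 when [Pr mu S = 0], as division by 0 gives 0. *)
Definition truncation (T : finType) (mu : T -> R) (S : {set T}) (x : T) : R :=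
  if x \in S then mu x / Pr mu S else 0.

Definition flip d (x : cube d) (i : 'I_d) : cube d :=
  [ffun j => if j == i then ~~ x j else x j].

(* For [0 < a] and [0 < d] this forces [0 < Pr mu S], so that the truncation
   is a genuine probability distribution. *)
Definition fat d (a : R) (mu : cube d -> R) (S : {set cube d}) : Prop :=
  forall i, a <= Pr (truncation mu S) [set x | flip x i \in S].

(* Logarithm bounded below by 1, for use inside O(.). *)
Definition log1 (t : R) : R := Num.max 1 (ln t).

End Distributions.

(* An adaptive algorithm as a finite interaction tree over a domain [T]: it can
   output a value, draw a fresh sample from the unknown distribution, or query
   an unknown subset of [T] at a point of its choice. *)
Inductive algorithm (T : finType) (O : Type) : Type :=
| Output (o : O)
| Sample (k : T -> algorithm T O)
| Query (x : T) (k : bool -> algorithm T O).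

(* Worst case over all samples and all oracle answers. *)
Fixpoint sample_complexity (T : finType) (O : Type) (A : algorithm T O) : nat :=
  match A with
  | Output _ => 0
  | Sample k => (\max_(x : T) sample_complexity (k x)).+1
  | Query _ k => maxn (sample_complexity (k true)) (sample_complexity (k false))
  end.

(* Probability that the output of [A] satisfies [E], when samples are drawn
   independently from [mu] and queries are answered by membership in [S]. *)
Fixpoint success_prob (R : realType) (T : finType) (O : Type)
    (mu : T -> R) (S : {set T}) (E : pred O) (A : algorithm T O) : R :=
  match A with
  | Output o => (E o)%:R
  | Sample k => \sum_(x : T) mu x * success_prob mu S E (k x)
  | Query x k => success_prob mu S E (k (x \in S))
  end.

(* Main.v *)
Require Import Defs.
From HB Require Import structures.
From mathcomp Require Import all_boot all_order all_algebra.
From mathcomp Require Import all_classical all_reals all_analysis.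
From mathcomp Require Import ring lra.
Import Order.TTheory GRing.Theory Num.Theory.
Local Open Scope ring_scope.

(** Given that both [x] and [flip x i] lie in [S], the bit [x i] is exactly
    Bernoulli with parameter [p i], so every sample of the truncation serves all
    coordinates at once: draw [n] samples, query all their flips, and estimate
    [p i] by the frequency of ones among the samples whose [i]-th flip is in [S].
    By fatness about [alpha * n] samples are usable for each coordinate, and an
    exponential moment bound gives, simultaneously for all [i] and with
    [n = O(d log(d/delta) / (eps^2 alpha))],
      [(q - p)^2 <= eps^2/d * (q(1-p) + p(1-q))].
    This scale-free deviation bounds [1 - BC^2] by [eps^2/d], where [BC] is the
    Bhattacharyya coefficient of the two Bernoulli laws. Since [BC] is
    multiplicative and [dTV^2 <= 1 - BC^2], the errors add up to [eps^2], rather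
    than total variation distances adding up to order [sqrt d * eps]. *)

(** * From the fidelity of Bernoulli factors to the total variation of products *)

Section Hellinger.
Context {R : realType}.

Lemma sum_cauchy_schwarz {T : finType} (f g : T -> R) :
  (\sum_x f x * g x) ^+ 2 <= (\sum_x f x ^+ 2) * (\sum_x g x ^+ 2).
Proof.
set A := \sum_x f x ^+ 2; set B := \sum_x _ * _; set C := \sum_x g x ^+ 2.
have C0 : 0 <= C by apply: sumr_ge0 => x _; exact: sqr_ge0.
have [C_eq0|C_neq0] := eqVneq C 0.
  have g0 x : g x = 0.
    apply/eqP; rewrite -sqrf_eq0.
    move/eqP: C_eq0; rewrite psumr_eq0 => [/allP/(_ x)|y _]; last exact: sqr_ge0.
    by rewrite mem_index_enum; apply.
  have -> : B = 0 by rewrite /B big1 // => x _; rewrite g0 mulr0.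
  by rewrite C_eq0 mulr0 expr0n.
have : 0 <= \sum_x (C * f x - B * g x) ^+ 2.
  by apply: sumr_ge0 => x _; exact: sqr_ge0.
have -> : \sum_x (C * f x - B * g x) ^+ 2 =
    C ^+ 2 * A - 2 * C * B * B + B ^+ 2 * C.
  rewrite [in LHS](eq_bigr (fun x => C ^+ 2 * f x ^+ 2
    + (- (2 * C * B) * (f x * g x) + B ^+ 2 * g x ^+ 2))); last by move=> x _; ring.
  by rewrite !big_split /= -!mulr_sumr -/A -/B -/C; ring.
have -> : C ^+ 2 * A - 2 * C * B * B + B ^+ 2 * C = C * (A * C - B ^+ 2) by ring.
by rewrite pmulr_rge0 ?subr_ge0 // lt_neqAle eq_sym C_neq0.
Qed.

(** The Bhattacharyya coefficient. *)
Definition fidelity {T : finType} (mu nu : T -> R) : R :=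
  \sum_x Num.sqrt (mu x) * Num.sqrt (nu x).

(** Cauchy-Schwarz after factoring [mu x - nu x] as difference times sum of the square roots: the
    two sums of squares are [2 - 2 * fidelity mu nu] and [2 + 2 * fidelity mu nu]. *)
Lemma dTV_sqr_le {T : finType} (mu nu : T -> R) :
  (forall x, 0 <= mu x) -> (forall x, 0 <= nu x) ->
  \sum_x mu x = 1 -> \sum_x nu x = 1 ->
  dTV mu nu ^+ 2 <= 1 - fidelity mu nu ^+ 2.
Proof.
move=> mu0 nu0 mu1 nu1.
have abs_diff x : `|mu x - nu x| =
    `|Num.sqrt (mu x) - Num.sqrt (nu x)| * (Num.sqrt (mu x) + Num.sqrt (nu x)).
  rewrite -[X in _ * X]ger0_norm ?addr_ge0 ?sqrtr_ge0 // -normrM -subr_sqr.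
  by rewrite !sqr_sqrtr.
have sum_sqr (e : R) : e ^+ 2 = 1 ->
    \sum_x (Num.sqrt (mu x) + e * Num.sqrt (nu x)) ^+ 2 =
    2 + 2 * e * fidelity mu nu.
  move=> e2.
  rewrite (eq_bigr (fun x => mu x +
      (nu x + 2 * e * (Num.sqrt (mu x) * Num.sqrt (nu x))))); last first.
    by move=> x _; rewrite sqrrD exprMn e2 !sqr_sqrtr //; ring.
  by rewrite !big_split /= mu1 nu1 -mulr_sumr addrA.
rewrite /dTV exprMn; under eq_bigr do rewrite abs_diff.
have := sum_cauchy_schwarz (fun x => `|Num.sqrt (mu x) - Num.sqrt (nu x)|)
  (fun x => Num.sqrt (mu x) + Num.sqrt (nu x)).
under [X in _ <= X * _ -> _]eq_bigr do
  rewrite real_normK ?num_real // -[- Num.sqrt _]mulN1r.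
under [X in _ <= _ * X -> _]eq_bigr do rewrite -[X in _ + X]mul1r.
rewrite !sum_sqr ?sqrrN ?expr1n // => h.
by move: h; set a := (\sum_x _) ^+ 2; set b := fidelity _ _; nra.
Qed.

Lemma sqrtr_prod {I : finType} (f : I -> R) : (forall i, 0 <= f i) ->
  Num.sqrt (\prod_i f i) = \prod_i Num.sqrt (f i).
Proof.
move=> f0; suff [] : Num.sqrt (\prod_i f i) = \prod_i Num.sqrt (f i) /\
  0 <= \prod_i f i by [].
elim/big_rec2: _ => [|i x y _ [<- y0]]; first by rewrite sqrtr1 ler01.
by rewrite sqrtrM // mulr_ge0.
Qed.

Lemma fidelity_product_pmf {d : nat} (p q : 'I_d -> R) :
  (forall i, 0 <= p i <= 1) -> (forall i, 0 <= q i <= 1) ->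
  fidelity (product_pmf p) (product_pmf q) =
  \prod_i fidelity (bernoulli_pmf (p i)) (bernoulli_pmf (q i)).
Proof.
move=> p01 q01; rewrite /fidelity bigA_distr_bigA /=.
apply: eq_bigr => x _; rewrite /product_pmf !sqrtr_prod ?big_split //=.
- by move=> i; exact: bernoulli_pmf_ge0.
- by move=> i; exact: bernoulli_pmf_ge0.
Qed.

Lemma product_pmf_ge0 {d : nat} (p : 'I_d -> R) (x : cube d) :
  (forall i, 0 <= p i <= 1) -> 0 <= product_pmf p x.
Proof. by move=> p01; apply: prodr_ge0 => i _; exact: bernoulli_pmf_ge0. Qed.

Lemma sum_product_pmf {d : nat} (p : 'I_d -> R) :
  \sum_x product_pmf p x = 1.
Proof.
rewrite /product_pmf -(bigA_distr_bigA (fun i b => bernoulli_pmf (p i) b)).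
by rewrite big1 // => i _; rewrite big_bool /bernoulli_pmf /=; ring.
Qed.

(** Put [u = sqrt (p (1 - q))] and [v = sqrt (q (1 - p))]. By Lagrange's identity the squared
    fidelity is [1 - (u - v)^2]. Since [p - q = u^2 - v^2], the hypothesis bounds
    [(u - v)^2 (u + v)^2] by [t (u^2 + v^2)], hence by [t (u + v)^2], and [(u + v)^2] cancels. *)
Lemma bernoulli_fidelity_ge (p q t : R) :
  0 <= p <= 1 -> 0 <= q <= 1 -> 0 <= t ->
  (q - p) ^+ 2 <= t * (q * (1 - p) + p * (1 - q)) ->
  1 - t <= fidelity (bernoulli_pmf p) (bernoulli_pmf q) ^+ 2 <= 1.
Proof.
move=> /andP[p0 p1] /andP[q0 q1] t0.
rewrite /fidelity big_bool /bernoulli_pmf /=.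
have p1' : 0 <= 1 - p by lra.
have q1' : 0 <= 1 - q by lra.
have := sqr_sqrtr p0; have := sqr_sqrtr p1'.
have := sqr_sqrtr q0; have := sqr_sqrtr q1'.
have := sqrtr_ge0 p; have := sqrtr_ge0 (1 - p).
have := sqrtr_ge0 q; have := sqrtr_ge0 (1 - q).
set a := Num.sqrt p; set b := Num.sqrt (1 - p).
set c := Num.sqrt q; set e := Num.sqrt (1 - q).
move=> e0 c0 b0 a0 eE cE bE aE.
have -> : (a * c + b * e) ^+ 2 = 1 - (a * e - b * c) ^+ 2.
  have -> : 1 = (a ^+ 2 + b ^+ 2) * (c ^+ 2 + e ^+ 2) :> R.
    by rewrite aE bE cE eE; ring.
  by ring.
have -> : (q - p) ^+ 2 = (a * e - b * c) ^+ 2 * (a * e + b * c) ^+ 2.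
  have -> : (a * e - b * c) ^+ 2 * (a * e + b * c) ^+ 2 =
    (a ^+ 2 * e ^+ 2 - b ^+ 2 * c ^+ 2) ^+ 2 by ring.
  by rewrite aE bE cE eE; ring.
have -> : q * (1 - p) + p * (1 - q) = (a * e) ^+ 2 + (b * c) ^+ 2.
  by rewrite !exprMn aE bE cE eE; ring.
have u0 : 0 <= a * e by rewrite mulr_ge0.
have v0 : 0 <= b * c by rewrite mulr_ge0.
move: (a * e) (b * c) u0 v0 => u v u0 v0 h.
rewrite lerD2l lerN2 gerBl sqr_ge0 andbT.
have [uv0|uv0] := eqVneq (u + v) 0.
    have -> : u = 0 by lra.
    have -> : v = 0 by lra.
    by rewrite subr0 expr0n.
have uv : 0 < (u + v) ^+ 2 by rewrite exprn_even_gt0.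
rewrite -(ler_pM2r uv); apply: (le_trans h); apply: ler_wpM2l => //.
by have := mulr_ge0 u0 v0; nra.
Qed.

Lemma one_sub_prod_le {I : finType} (u : I -> R) (t : R) :
  (forall i, 1 - t <= u i <= 1) -> 0 <= t <= 1 ->
  1 - \prod_i u i <= #|I|%:R * t.
Proof.
move=> uP /andP[t0 t1]; rewrite mulr_natl -sumr_const.
(* As the partial products stay in [[0, 1]], each new factor costs at most [t]. *)
suff [] : 1 - \prod_i u i <= \sum_(i in I) t /\ 0 <= \prod_i u i <= 1 by [].
rewrite (eq_bigl xpredT) //.
elim/big_rec2: _ => [|i x y _ [h /andP[y0 y1]]]; first by split; lra.
by have /andP[u1 u2] := uP i; split; [nra|apply/andP; split; nra].
Qed.

Lemma dTV_product_pmf_le1 {d : nat} (p q : 'I_d -> R) :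
  (forall i, 0 <= p i <= 1) -> (forall i, 0 <= q i <= 1) ->
  dTV (product_pmf p) (product_pmf q) <= 1.
Proof.
move=> p01 q01.
have h := dTV_sqr_le (product_pmf p) (product_pmf q)
  (fun x => product_pmf_ge0 p x p01) (fun x => product_pmf_ge0 q x q01)
  (sum_product_pmf p) (sum_product_pmf q).
have : dTV (product_pmf p) (product_pmf q) ^+ 2 <= 1.
  by apply: (le_trans h); rewrite gerBl sqr_ge0.
by set a := dTV _ _; nra.
Qed.

Lemma dTV_product_pmf_le {d : nat} (p q : 'I_d -> R) (eps : R) :
  (0 < d)%N -> 0 < eps <= 1 ->
  (forall i, 0 <= p i <= 1) -> (forall i, 0 <= q i <= 1) ->
  (forall i, (q i - p i) ^+ 2 <=
     eps ^+ 2 / d%:R * (q i * (1 - p i) + p i * (1 - q i))) ->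
  dTV (product_pmf p) (product_pmf q) <= eps.
Proof.
move=> d0 /andP[eps0 eps1] p01 q01 pq.
have dR : 1 <= d%:R :> R by rewrite ler1n.
have t0 : 0 <= eps ^+ 2 / d%:R by rewrite divr_ge0 ?sqr_ge0.
have t1 : eps ^+ 2 / d%:R <= 1 by rewrite ler_pdivrMr; nra.
rewrite -(ler_pXn2r (ltn0Sn 1)) ?nnegrE ?(ltW eps0) //; last first.
  by rewrite mulr_ge0 ?invr_ge0 // sumr_ge0.
apply: le_trans (dTV_sqr_le _ _ _ _ _ _) _.
- by move=> x; exact: product_pmf_ge0.
- by move=> x; exact: product_pmf_ge0.
- exact: sum_product_pmf.
- exact: sum_product_pmf.
rewrite fidelity_product_pmf // -prodrXl.
apply: le_trans (one_sub_prod_le _ (eps ^+ 2 / d%:R) _ _) _.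
- by move=> i; apply: bernoulli_fidelity_ge.
- by rewrite t0 t1.
- by rewrite card_ord mulrC divfK // pnatr_eq0 -lt0n.
Qed.

End Hellinger.

Lemma ler_indicator {R : realType} (P Q : bool) :
  (P -> Q) -> P%:R <= Q%:R :> R.
Proof. by case: P => [->|_] //=; exact: ler0n. Qed.

(** * Means over independent samples and Chernoff's method *)

Section IidMean.
Context {R : realType} {T : finType} (mu : T -> R).

(** The recursion follows the nesting of [Sample] nodes, so it matches [success_prob] draw by draw.
    Probabilities are means of 0-1 indicators. *)
Fixpoint iid_mean (n : nat) (F : seq T -> R) : R :=
  if n is m.+1 then \sum_x mu x * iid_mean m (fun s => F (x :: s)) else F [::].

Lemma iid_mean_sum (I : finType) n (F : I -> seq T -> R) :
  iid_mean n (fun s => \sum_i F i s) = \sum_i iid_mean n (F i).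
Proof.
elim: n F => //= n IH F; rewrite exchange_big /=.
by apply: eq_bigr => x _; rewrite IH mulr_sumr.
Qed.

Lemma iid_meanD n (F G : seq T -> R) :
  iid_mean n (fun s => F s + G s) = iid_mean n F + iid_mean n G.
Proof.
elim: n F G => //= n IH F G; rewrite -big_split /=.
by apply: eq_bigr => x _; rewrite IH mulrDr.
Qed.

Lemma iid_meanZ n (c : R) (F : seq T -> R) :
  iid_mean n (fun s => c * F s) = c * iid_mean n F.
Proof.
elim: n F => //= n IH F; rewrite mulr_sumr.
by apply: eq_bigr => x _; rewrite IH mulrCA.
Qed.

Lemma iid_mean_prod n (w : T -> R) :
  iid_mean n (fun s => \prod_(x <- s) w x) = (\sum_x mu x * w x) ^+ n.
Proof.
elim: n => [|n IH] /=; first by rewrite big_nil.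
rewrite exprS mulr_suml; apply: eq_bigr => x _.
rewrite -mulrA -IH -[w x * _]iid_meanZ; congr (_ * iid_mean n _).
by apply: funext => s; rewrite big_cons.
Qed.

Hypothesis mu_ge0 : forall x, 0 <= mu x.

Lemma ler_iid_mean n (F G : seq T -> R) :
  (forall s, size s = n -> F s <= G s) -> iid_mean n F <= iid_mean n G.
Proof.
elim: n F G => [|n IH] F G FG /=; first exact: FG.
apply: ler_sum => x _; apply: ler_wpM2l => //; apply: IH => s sn.
by apply: FG; rewrite /= sn.
Qed.

(** The indicator is at most [expR (\sum Z - c)], whose mean factors by independence into
    [expR (- c)] times an [n]-th power of a number at most 1. *)
Lemma iid_exp_tail n (Z : T -> R) (c : R) :
  \sum_x mu x * expR (Z x) <= 1 ->
  iid_mean n (fun s => (c <= \sum_(x <- s) Z x)%R%:R) <= expR (- c).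
Proof.
move=> Z1; apply: (@le_trans _ _
  (iid_mean n (fun s => expR (- c) * \prod_(x <- s) expR (Z x)))).
  apply: ler_iid_mean => s _; rewrite -expR_sum -expRD.
  case: (leP c) => [cZ|_] /=; last exact: expR_ge0.
  by rewrite -expR0 ler_expR; lra.
rewrite iid_meanZ iid_mean_prod ler_piMr ?expR_ge0 // exprn_ile1 //.
by apply: sumr_ge0 => x _; rewrite mulr_ge0 ?expR_ge0.
Qed.

Hypothesis mu_sum1 : \sum_x mu x = 1.

Lemma iid_mean_cst n (c : R) : iid_mean n (fun=> c) = c.
Proof. by elim: n => //= n ->; rewrite -mulr_suml mu_sum1 mul1r. Qed.

End IidMean.

(** * Empirical frequency of a bit among usable samples *)

Section Frequency.
Context {F : realFieldType} {T : Type} (U b : pred T).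

(** The field is generic because the learner computes in [rat] and the analysis in the reals.
    Without usable samples the value is 0. *)
Definition freq (s : seq T) : F := (count (predI U b) s)%:R / (count U s)%:R.

Lemma freq_itv (s : seq T) : 0 <= freq s <= 1.
Proof.
rewrite /freq divr_ge0 //=.
have le_count : (count (predI U b) s <= count U s)%N.
  by apply: sub_count => x /andP[].
case: (posnP (count U s)) => [->|c0]; first by rewrite invr0 mulr0.
by rewrite ler_pdivrMr ?ltr0n // mul1r ler_nat.
Qed.

End Frequency.

(** * Tail bounds for the empirical frequency *)

Section ConditionalBernoulli.
Context {R : realType} {T : finType} (mu : T -> R) (U b : pred T) (p a : R).

(** [expR y * (1 - y) <= 1], while [(1 + y + 2 y^2) (1 - y) = 1 + y^2 (1 - 2 y)] is at least 1. *)
Lemma expR_le_quadratic (y : R) : y <= 2^-1 -> expR y <= 1 + y + 2 * y ^+ 2.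
Proof.
move=> y2; have h := expR_ge1Dx (- y).
have y1 : 0 < 1 - y by lra.
have : expR y * (1 - y) <= 1.
  by rewrite -[leRHS](expRxMexpNx_1 y) ler_pM2l ?expR_gt0.
have := expR_gt0 y; set e := expR y => e0 ey.
rewrite -(ler_pM2r y1); apply: (le_trans ey).
by have := sqr_ge0 y; nra.
Qed.

(** In the quadratic bound the linear terms cancel, the variable being centred, and the squares
    average to the variance [p * (1 - p)]. *)
Lemma bernoulli_mgf_le (lam : R) : 0 <= p <= 1 -> 0 <= lam <= 2^-1 ->
  p * expR (lam * (1 - p)) + (1 - p) * expR (lam * (0 - p)) <=
  expR (2 * lam ^+ 2 * (p * (1 - p))).
Proof.
move=> /andP[p0 p1] /andP[l0 l1].
apply: le_trans (expR_ge1Dx _).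
have h1 : lam * (1 - p) <= 2^-1 by nra.
have h2 : lam * (0 - p) <= 2^-1 by nra.
have p1' : 0 <= 1 - p by lra.
have := lerD (ler_wpM2l p0 (expR_le_quadratic _ h1))
             (ler_wpM2l p1' (expR_le_quadratic _ h2)).
move=> /le_trans; apply; rewrite le_eqVlt; apply/orP; left; apply/eqP; ring.
Qed.

(** Upward deviations only; downward ones are upward deviations of the complementary bit, with
    [1 - p] for [p]. *)
Definition excess (t : R) (s : seq T) : bool :=
  (p < freq U b s) &&
  (t * (freq U b s * (1 - p) + p * (1 - freq U b s)) < (freq U b s - p) ^+ 2).

(* The frequency of a sample of size [n] takes finitely many values, so the
   excessive ones have a minimum. *)
Lemma excess_min (n : nat) (t : R) :
  (forall s, size s = n -> ~~ excess t s) \/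
  exists x, [/\ p < x, x <= 1,
    t * (x * (1 - p) + p * (1 - x)) < (x - p) ^+ 2
    & forall s, size s = n -> excess t s -> x <= freq U b s].
Proof.
pose v (k : 'I_n.+1 * 'I_n.+1) : R := (k.1)%:R / (k.2)%:R.
pose P k := [&& p < v k, v k <= 1 &
  t * (v k * (1 - p) + p * (1 - v k)) < (v k - p) ^+ 2].
have vP s : size s = n -> exists k, freq U b s = v k.
  move=> sn; exists (inord (count (predI U b) s), inord (count U s)).
  by rewrite /v /= !inordK ?ltnS -?sn ?count_size.
case: (pickP P) => [k0 Pk0|P0]; [right|left].
  case: (arg_minP v Pk0) => k /and3P[pv v1 tv] kmin; exists (v k); split=> //.
  move=> s sn /andP[ps ts]; have [j fE] := vP s sn.
  by rewrite fE; apply: kmin; rewrite /P -fE ps ts; have /andP[_ ->] := freq_itv (F := R) U b s.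
move=> s sn; apply/negP => /andP[ps ts]; have [j fE] := vP s sn.
by have := P0 j; rewrite /P -fE ps ts; have /andP[_ ->] := freq_itv (F := R) U b s.
Qed.

Hypotheses (mu_ge0 : forall x, 0 <= mu x) (mu_sum1 : \sum_x mu x = 1).
Hypotheses (muU : \sum_(x | U x) mu x = a)
  (muUb : \sum_(x | U x && b x) mu x = p * a).
Hypothesis p01 : 0 <= p <= 1.

Lemma usable_mass_itv : 0 <= a <= 1.
Proof.
apply/andP; split; first by rewrite -muU sumr_ge0.
by rewrite -mu_sum1 (bigID U) /= muU lerDl sumr_ge0.
Qed.

(** Both tail bounds use an exponent that is constant on the three classes of masses [p * a],
    [(1 - p) * a] and [1 - a]. *)
Lemma mean_exp_usable (u v w : R) :
  \sum_x mu x * expR (if U x then if b x then u else v else w) =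
  a * (p * expR u + (1 - p) * expR v) + (1 - a) * expR w.
Proof.
have muUnb : \sum_(x | U x && ~~ b x) mu x = (1 - p) * a.
  by move: muU; rewrite (bigID b) /= muUb => h; apply: (addrI (p * a)); rewrite h; ring.
have muUn : \sum_(x | ~~ U x) mu x = 1 - a.
  by move: mu_sum1; rewrite (bigID U) /= muU => h; apply: (addrI a); rewrite h; ring.
rewrite (bigID U) /= (bigID b) /=.
rewrite (eq_bigr (fun x => mu x * expR u)); last by move=> x /andP[-> ->].
rewrite [X in _ + X + _](eq_bigr (fun x => mu x * expR v)); last first.
  by move=> x /andP[-> /negPf->].
rewrite [X in _ + _ + X](eq_bigr (fun x => mu x * expR w)); last first.
  by move=> x /negPf->.
by rewrite -!mulr_suml muUb muUnb muUn; ring.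
Qed.

(** With exponent [a / 2] minus the indicator of [U], the exponential moment is
    [expR (a / 2) * (1 - a + a * expR (-1))]. Since [expR (-1) <= 1/2], this is at most
    [expR (a / 2) * (1 - a / 2) <= 1]. *)
Lemma usable_lower_tail n :
  iid_mean mu n (fun s => ((count U s)%:R <= n%:R * a / 4)%R%:R)
    <= expR (- (n%:R * a / 4)).
Proof.
pose Z x := if U x then if b x then a / 2 - 1 else a / 2 - 1 else a / 2.
have ZE s : \sum_(x <- s) Z x = (size s)%:R * a / 2 - (count U s)%:R.
  elim: s => [|x s IH]; first by rewrite big_nil /=; ring.
  by rewrite big_cons IH /Z /= if_same natrD -natr1; case: (U x) => /=; field.
apply: le_trans (iid_exp_tail mu mu_ge0 n Z (n%:R * a / 4) _).
  apply: ler_iid_mean => // s sn; rewrite ZE sn.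
  by apply: ler_indicator; lra.
have /andP[a0 a1] := usable_mass_itv.
rewrite /Z mean_exp_usable expRD -mulrDl subrKC mul1r.
have : (1 - a / 2) * expR (a / 2) <= 1.
  rewrite -[leRHS](expRxMexpNx_1 (a / 2)) [leRHS]mulrC ler_pM2r ?expR_gt0 //.
  exact: expR_ge1Dx.
have e1 : expR (-1) <= 2^-1 :> R.
  have := expR_ge1Dx (1 : R); rewrite expRN => e2.
  by rewrite lef_pV2 ?posrE ?expR_gt0 //; lra.
have := expR_gt0 (a / 2); set e := expR (a / 2) => e0.
have : a * (e * expR (-1)) <= a * (e * 2^-1) by rewrite !ler_wpM2l // ltW.
by lra.
Qed.

(** One exponent, tuned to the least excessive frequency [x], serves all excessive samples: each of
    the at least [c] usable draws contributes [t / 8] or more on average. *)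
Lemma excess_tail n (t c : R) : 0 < t -> 0 <= c ->
  iid_mean mu n (fun s => ((c <= (count U s)%:R) && excess t s)%R%:R)
    <= expR (- (c * t / 8)).
Proof.
move=> t0 c0.
have [none|[x [px x1 tx xmin]]] := excess_min n t.
  apply: (@le_trans _ _ (iid_mean mu n (fun=> 0))).
    by apply: ler_iid_mean => // s sn; rewrite (negPf (none s sn)) andbF.
  by rewrite iid_mean_cst // expR_ge0.
have /andP[p0 p1] := p01.
pose V := x * (1 - p) + p * (1 - x).
(* This keeps [lam] below [1/2], the range of [bernoulli_mgf_le], and makes [V] positive. *)
have DV : x - p <= V by rewrite /V; nra.
have VD : p * (1 - p) <= V by rewrite /V; nra.
have V0 : 0 < V by lra.
(* Maximizes the exponent [lam * (x - p) - 2 * lam ^+ 2 * V] gained per usable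
   sample; [p * (1 - p) <= V] makes [V] an admissible variance proxy. *)
pose lam := (x - p) / (4 * V).
have lam0 : 0 <= lam by rewrite /lam divr_ge0; lra.
have lam1 : lam <= 2^-1 by rewrite /lam ler_pdivrMr; lra.
have lamV : 4 * lam * V = x - p by rewrite /lam; field; lra.
pose r := 2 * lam ^+ 2 * V.
pose Z y := if U y then if b y then lam * (1 - p) - r else lam * (0 - p) - r else 0.
have ZE s : \sum_(y <- s) Z y =
    lam * (count (predI U b) s)%:R - (lam * p + r) * (count U s)%:R.
  elim: s => [|y s IH]; first by rewrite big_nil /=; ring.
  rewrite big_cons IH /Z /= !natrD.
  by case: (U y); case: (b y) => /=; ring.
apply: le_trans (iid_exp_tail mu mu_ge0 n Z (c * t / 8) _).
  apply: ler_iid_mean => // s sn; apply: ler_indicator => /andP[cs es].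
  have xs := xmin s sn es; rewrite ZE.
  (* With no usable sample [freq] is 0, below [x > p >= 0]. *)
  have [cU0|cU0] := posnP (count U s).
    by move: xs; rewrite /freq cU0 invr0 mulr0; lra.
  have N0 : 0 < (count U s)%:R :> R by rewrite ltr0n.
  have -> : (count (predI U b) s)%:R = freq U b s * (count U s)%:R :> R.
    by rewrite /freq divfK // lt0r_neq0.
  move: (freq U b s) (count U s)%:R xs cs N0 => f N xs cs N0.
  (* As [x - p = 4 lam V], the excess at [x] reads [t < 16 lam^2 V], and the gain at [f = x] is
     [4 lam^2 V - r = 2 lam^2 V]. *)
  have ht : t / 8 <= lam * f - (lam * p + r).
    have : t < 16 * lam ^+ 2 * V.
      rewrite -(ltr_pM2r V0) (lt_le_trans tx) // -lamV.
      by rewrite le_eqVlt; apply/orP; left; apply/eqP; ring.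
    have : lam * (f - p) >= lam * (x - p) by rewrite ler_wpM2l //; lra.
    by rewrite -lamV /r; nra.
  have : c * (t / 8) <= N * (t / 8) by rewrite ler_wpM2r // divr_ge0 // ltW.
  by have := ler_wpM2l (ltW N0) ht; lra.
have /andP[a0 a1] := usable_mass_itv.
have mgf := bernoulli_mgf_le lam p01; rewrite lam0 lam1 in mgf.
have {}mgf := mgf isT.
rewrite /Z mean_exp_usable expR0 mulr1 !expRD !mulrA -mulrDl.
have : (p * expR (lam * (1 - p)) + (1 - p) * expR (lam * (0 - p))) * expR (- r) <= 1.
  rewrite -[leRHS](expRxMexpNx_1 r) ler_pM2r ?expR_gt0 //.
  apply: (le_trans mgf); rewrite ler_expR /r ler_wpM2l //.
  by rewrite mulr_ge0 ?sqr_ge0.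
set m := (_ * expR (- r)) => m1.
by have := ler_wpM2l a0 m1; lra.
Qed.

End ConditionalBernoulli.

(** Union bound over three events: too few usable samples, upward excess, downward excess. The last
    is the upward excess of [predC b], the tolerance being invariant when [f] and [p] are replaced
    by [1 - f] and [1 - p]. *)
Lemma deviation_tail {R : realType} {T : finType} (mu : T -> R) (U b : pred T)
    (p a t : R) (n : nat) :
  (forall x, 0 <= mu x) -> \sum_x mu x = 1 ->
  \sum_(x | U x) mu x = a -> \sum_(x | U x && b x) mu x = p * a ->
  0 <= p <= 1 -> 0 < t <= 8 ->
  iid_mean mu n (fun s =>
    (t * (freq U b s * (1 - p) + p * (1 - freq U b s)) <
      (freq U b s - p) ^+ 2)%R%:R)
    <= 3 * expR (- (n%:R * a / 4 * t / 8)).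
Proof.
move=> mu0 mu1 muU muUb p01 /andP[t0 t8].
have /andP[a0 a1] := usable_mass_itv mu U a mu0 mu1 muU.
have /andP[p0 p1] := p01.
pose c := n%:R * a / 4.
have c0 : 0 <= c by rewrite /c !mulr_ge0 ?ler0n.
have muUnb : \sum_(x | U x && predC b x) mu x = (1 - p) * a.
  by move: muU; rewrite (bigID b) /= muUb => h; apply: (addrI (p * a)); rewrite h; ring.
have pn01 : 0 <= 1 - p <= 1 by lra.
pose low s := ((count U s)%:R <= c)%R%:R : R.
pose up s := ((c <= (count U s)%:R) && excess U b p t s)%R%:R : R.
pose dn s := ((c <= (count U s)%:R) && excess U (predC b) (1 - p) t s)%R%:R : R.
apply: (@le_trans _ _ (iid_mean mu n (fun s => low s + (up s + dn s)))).
  apply: ler_iid_mean => // s _; rewrite /low /up /dn.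
  have [_|cN] := leP (count U s)%:R c.
    by rewrite -[leLHS]addr0 lerD ?addr_ge0 ?ler0n // (ler_indicator _ true).
  rewrite (ltW cN) /= add0r.
  have N0 : 0 < (count U s)%:R :> R by apply: le_lt_trans cN.
  have fC : freq U (predC b) s = 1 - freq U b s :> R.
    have NE : (count U s)%:R =
        (count (predI U b) s)%:R + (count (predI U (predC b)) s)%:R :> R.
      elim: s {cN N0} => [|x s IH] /=; first by rewrite addr0.
      by rewrite !natrD IH; case: (U x); case: (b x) => /=; ring.
    have := lt0r_neq0 N0.
    by rewrite /freq NE => ?; field.
  have /andP[f0 f1] := freq_itv (F := R) U b s.
  rewrite /excess fC; move: (freq U b s) f0 f1 => f f0 f1.
  have -> : 1 - f - (1 - p) = - (f - p) by ring.
  have -> : (1 - f) * (1 - (1 - p)) + (1 - p) * (1 - (1 - f)) =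
    f * (1 - p) + p * (1 - f) by ring.
  rewrite sqrrN; case: ltP => [tV|_]; last by rewrite addr_ge0.
  rewrite !andbT /=; case: (ltgtP p f) => [_|fp|pf].
  - by rewrite lerDl ler0n.
  - have -> : 1 - p < 1 - f by lra.
    by rewrite /= add0r.
  - move: tV; rewrite pf subrr expr0n /= ltNge => /negP[].
    by rewrite mulr_ge0 ?(ltW t0) // addr_ge0 // mulr_ge0 //; lra.
rewrite !iid_meanD.
have h1 := usable_lower_tail mu U b p a mu0 mu1 muU muUb n.
have h2 := excess_tail mu U b p a mu0 mu1 muU muUb p01 n t c t0 c0.
have h3 := excess_tail mu U (predC b) (1 - p) a mu0 mu1 muU muUnb pn01 n t c t0 c0.
(* Here [t <= 8] lets the shortage of usable samples obey the same bound as the deviations. *)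
have h4 : expR (- c) <= expR (- (c * t / 8)).
  by rewrite ler_expR lerN2 -mulrA ler_piMr //; lra.
rewrite -/c -/c in h1 *.
have -> : 3 * expR (- (c * t / 8)) =
  expR (- (c * t / 8)) + (expR (- (c * t / 8)) + expR (- (c * t / 8))) by ring.
by apply: lerD; [exact: le_trans h4|exact: lerD].
Qed.

(** * Conditional law of a bit under truncation *)

Section FatTruncation.
Context {R : realType} {d : nat} (p : 'I_d -> R) (S : {set cube d}).
Hypothesis p01 : forall i, 0 <= p i <= 1.
Let D := product_pmf p.

Lemma flipK (i : 'I_d) : involutive (fun x : cube d => flip x i).
Proof. by move=> x; apply/ffunP => j; rewrite !ffunE; case: eqP; rewrite ?negbK. Qed.

(** The two weights differ only in the factor at [i]; cross-multiplying covers [p i = 0] as well. *)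
Lemma product_pmf_flip (x : cube d) (i : 'I_d) :
  x i -> p i * D (flip x i) = (1 - p i) * D x.
Proof.
move=> xi; rewrite /D /product_pmf (bigD1 i) //= [in RHS](bigD1 i) //=.
rewrite ffunE eqxx xi /bernoulli_pmf /= !mulrA [p i * _]mulrC; congr (_ * _).
by apply: eq_bigr => j /negPf ji; rewrite ffunE ji.
Qed.

Lemma truncation_ge0 (x : cube d) : 0 <= truncation D S x.
Proof.
rewrite /truncation; case: ifP => // _.
by rewrite divr_ge0 ?sumr_ge0 // => *; exact: product_pmf_ge0.
Qed.

(** If [S] had mass 0, the truncation would vanish, contradicting fatness at [i]. *)
Lemma sum_truncation (i : 'I_d) (alpha : R) :
  0 < alpha -> fat alpha D S -> \sum_x truncation D S x = 1.
Proof.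
move=> alpha0 /(_ i) fatS.
have Z0 : Pr D S != 0.
  apply/eqP => Z0; move: fatS; rewrite leNgt => /negP[].
  rewrite /Pr big1 // => x _; rewrite /truncation Z0 invr0 mulr0.
  by case: ifP.
by rewrite /truncation -big_mkcond -mulr_suml divff.
Qed.

(* Pairing [x] with [flip x i] shows that, given that both lie in [S], the
   [i]-th bit is still Bernoulli with parameter [p i]. *)
Lemma truncation_flip_bernoulli (i : 'I_d) :
  \sum_(x : cube d | (flip x i \in S) && x i) truncation D S x =
  p i * \sum_(x : cube d | flip x i \in S) truncation D S x.
Proof.
set M1 := LHS.
pose M0 := \sum_(x : cube d | (flip x i \in S) && ~~ x i) truncation D S x.
have -> : \sum_(x : cube d | flip x i \in S) truncation D S x = M1 + M0.
  by rewrite (bigID (fun x : cube d => x i)).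
suff : (1 - p i) * M1 = p i * M0 by lra.
(* Reindexed by the flip, [M0] also runs over points with bit one. In both sums a term vanishes
   unless [x] and [flip x i] lie in [S], and then [product_pmf_flip] matches them. *)
rewrite /M0 (reindex_inj (inv_inj (flipK i))) /M1 !mulr_sumr /=.
rewrite big_mkcond [RHS]big_mkcond /=; apply: eq_bigr => x _.
rewrite flipK ffunE eqxx negbK /truncation.
case: (boolP (x i)) => xi; rewrite ?andbF ?andbT //.
by case: (x \in S); case: (flip x i \in S); rewrite ?mulr0 // !mulrA product_pmf_flip.
Qed.

End FatTruncation.

(** * Building blocks of interaction trees *)

Section Algorithms.
Context {T : finType} {O : Type}.

Fixpoint draw (n : nat) (k : seq T -> algorithm T O) : algorithm T O :=
  if n is m.+1 then Sample (fun x => draw m (fun s => k (x :: s))) else k [::].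

(** The continuation receives the set of points answered positively, a surrogate for the unknown set
    on [l]. *)
Fixpoint ask (l : seq T) (k : {set T} -> algorithm T O) : algorithm T O :=
  if l is x :: l' then
    Query x (fun b => ask l' (fun B => k (if b then x |: B else B)))
  else k finset.set0.

Lemma success_prob_draw {R : realType} (mu : T -> R) (S : {set T}) (E : pred O) n k :
  success_prob mu S E (draw n k) =
  iid_mean mu n (fun s => success_prob mu S E (k s)).
Proof. by elim: n k => //= n IH k; apply: eq_bigr => x _; rewrite IH. Qed.

Lemma success_prob_ask {R : realType} (mu : T -> R) (S : {set T}) (E : pred O) l k :
  success_prob mu S E (ask l k) = success_prob mu S E (k [set x in l | x \in S]).
Proof.
elim: l k => [|x l IH] k /=.
  by congr (success_prob _ _ _ (k _)); apply/setP => y; rewrite !inE.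
rewrite IH; congr (success_prob _ _ _ (k _)); apply/setP => y.
by case: ifP => xS; rewrite !inE; case: eqP => // ->; rewrite xS ?andbF ?andbT.
Qed.

Lemma sample_complexity_draw_le n m k :
  (forall s, sample_complexity (k s) <= m)%N ->
  (sample_complexity (draw n k) <= n + m)%N.
Proof.
elim: n k => [|n IH] k km //=; rewrite addSn ltnS.
by apply/bigmax_leqP => x _; exact: IH.
Qed.

Lemma sample_complexity_ask_le l m k :
  (forall B, sample_complexity (k B) <= m)%N ->
  (sample_complexity (ask l k) <= m)%N.
Proof. by elim: l k => [|x l IH] k km //=; rewrite geq_max !IH. Qed.

End Algorithms.

(** * The learner and its rational estimates *)

Section Learner.
Context {d : nat}.

Definition usable (B : {set cube d}) (i : 'I_d) : pred (cube d) :=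
  fun x => flip x i \in B.

Definition bit (i : 'I_d) : pred (cube d) := fun x => x i.

Definition estimate (s : seq (cube d)) (B : {set cube d}) (i : 'I_d) : {i01 rat} :=
  let f01 := andP (freq_itv (F := rat) (usable B i) (bit i) s) in
  Itv01 (proj1 f01) (proj2 f01).

Definition learner (n : nat) : algorithm (cube d) ('I_d -> {i01 rat}) :=
  draw n (fun s => ask [seq flip x i | x <- s, i <- enum 'I_d]
    (fun B => Output _ (estimate s B))).

Lemma success_prob_learner {R : realType} (mu : cube d -> R) (S : {set cube d}) E n :
  success_prob mu S E (learner n) = iid_mean mu n (fun s =>
    (E (estimate s [set x in [seq flip x i | x <- s, i <- enum 'I_d] | x \in S]))%:R).
Proof.
by rewrite success_prob_draw; congr iid_mean; apply: funext => s; rewrite success_prob_ask.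
Qed.

Lemma sample_complexity_learner n : (sample_complexity (learner n) <= n)%N.
Proof.
rewrite -[leqRHS]addn0; apply: sample_complexity_draw_le => s.
exact: sample_complexity_ask_le.
Qed.

(** The estimate tests membership only at flips of samples, and these were all queried, so the
    surrogate set agrees with [S] there. *)
Lemma ratr_estimate {R : realType} (s : seq (cube d)) (S : {set cube d}) (i : 'I_d) :
  ratr (estimate s [set x in [seq flip x i | x <- s, i <- enum 'I_d] | x \in S] i)%:num
  = freq (usable S i) (bit i) s :> R.
Proof.
have E : {in s, usable [set x in [seq flip x i | x <- s, i <- enum 'I_d] | x \in S] i
    =1 usable S i}.
  move=> x xs; rewrite /usable inE; case: (boolP (_ \in S)); rewrite ?andbF // andbT.
  by move=> _; apply: allpairs_f; rewrite ?mem_enum.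
rewrite /estimate /= /freq fmorph_div /= !ratr_nat (eq_in_count E).
by congr (_%:R / _); apply: eq_in_count => x xs /=; rewrite E.
Qed.

End Learner.

(** * Sample size and union bound over the coordinates *)

Lemma failure_exponent {R : realType} (x L : R) :
  0 < x -> L = log1 x -> 3 * expR (- (3 * L)) <= x^-1.
Proof.
move=> x0 LE.
have L1 : 1 <= L by rewrite LE /log1 le_max lexx.
have Lx : x <= expR L by rewrite -[leLHS]lnK ?posrE // ler_expR LE /log1 le_max lexx orbT.
(* One [L], at least [ln x], yields [x^-1]; the other two, with [L >= 1], absorb the factor 3. *)
have -> : - (3 * L) = - L + - (2 * L) by ring.
rewrite expRD mulrCA -[leRHS]mulr1; apply: ler_pM; rewrite ?expR_ge0 ?mulr_ge0 ?expR_ge0 //.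
  by rewrite expRN lef_pV2 ?posrE ?expR_gt0.
have : 3 <= expR (2 * L).
  by apply: le_trans (expR_ge1Dx _); lra.
rewrite expRN => h; rewrite ler_pdivrMr ?mul1r // ?expR_gt0 //.
Qed.

Theorem corollary4 (R : realType) :
  exists C : R, 0 < C /\
  forall (d : nat) (alpha eps delta : R),
    (0 < d)%N -> 0 < alpha -> 0 < eps -> 0 < delta ->
  exists A : algorithm (cube d) ('I_d -> {i01 rat}),
    (sample_complexity A)%:R
      <= C * (d%:R * log1 (d%:R : R) * log1 (d%:R / delta)
              / (eps ^+ 2 * alpha)) /\
    forall (p : 'I_d -> {i01 R}) (S : {set cube d}),
      let D := product_pmf (fun i => (p i)%:num) in
      fat alpha D S ->
      1 - delta <=
        success_prob (truncation D S) S
          (fun q => dTV D (product_pmf (fun i => ratr (q i)%:num)) <= eps) A.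
Proof.
(* 96 comes from the exponent, and 1 more pays for rounding up. *)
exists 97; split=> // d alpha eps delta d0 alpha0 eps0 delta0.
have dR : 1 <= d%:R :> R by rewrite ler1n.
have log1_ge1 x : 1 <= log1 x :> R by rewrite /log1 le_max lexx.
set L := log1 (d%:R / delta); set Y := _ / _.
have L1 : 1 <= L by exact: log1_ge1.
have E0 : 0 < eps ^+ 2 * alpha by rewrite mulr_gt0 ?exprn_gt0.
have Y0 : 0 <= Y by rewrite divr_ge0 ?(ltW E0) // !mulr_ge0 // (le_trans ler01).
have p01 (p : 'I_d -> {i01 R}) i : 0 <= (p i)%:num <= 1 by rewrite ge0 le1.
have q01 (q : 'I_d -> {i01 rat}) i : 0 <= (ratr (q i)%:num : R) <= 1.
  by rewrite ler0q -[X in _ && (_ <= X)](ratr_nat R 1) ler_rat ge0 le1.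
pose q0 : 'I_d -> {i01 rat} := fun=> Itv01 (lexx 0) ler01.
have [eps1|eps1] := leP 1 eps.
  exists (Output _ q0); split; first by rewrite mulr_ge0.
  move=> p S D _; rewrite /success_prob.
  rewrite (le_trans (dTV_product_pmf_le1 _ _ (p01 p) (q01 q0)) eps1).
  by rewrite gerBl ltW.
(* No truncation is fat for [alpha > 1], a probability being at most 1. The remaining range gives
   [eps ^+ 2 * alpha <= 1], whence [96 <= X]. *)
have [alpha1|alpha1] := ltP 1 alpha.
exists (Output _ (fun=> 0%:i01)); split; first by rewrite mulr_ge0.
  move=> p S D fatS; have i := Ordinal d0.
  have := usable_mass_itv _ (usable S i) _ (truncation_ge0 _ S (p01 p))
    (sum_truncation _ S i alpha alpha0 fatS) (erefl _).
  move=> /andP[_]; rewrite leNgt => /negP[].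
  apply: (lt_le_trans alpha1); apply: (le_trans (fatS i)).
  by rewrite /Pr (eq_bigl (usable S i)) // => x; rewrite inE.
pose X := 96 * (d%:R * L / (eps ^+ 2 * alpha)).
have X1 : 96 <= X.
  rewrite /X ler_peMr // ler_pdivlMr // mul1r.
  have : eps ^+ 2 <= 1 by nra.
  have : 1 <= d%:R * L by nra.
  by nra.
(* The two sides differ by the factor [log1 d], which is at least 1. *)
have XY : X <= 96 * Y.
  rewrite ler_pM2l // /Y ler_pM2r ?invr_gt0 // ler_pM2r; last by lra.
  by rewrite ler_peMr //; lra.
pose n := (Num.truncn X).+1.
have Xn : X < n%:R by rewrite truncnS_gt.
exists (learner n); split.
  apply: (@le_trans _ _ n%:R); first by rewrite ler_nat sample_complexity_learner.
  have : (Num.truncn X)%:R <= X by rewrite truncn_le; lra.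
  by rewrite /n -natr1; lra.
move=> p S D fatS; set mu := truncation D S.
have i0 := Ordinal d0.
have mu0 x : 0 <= mu x by exact: (truncation_ge0 _ S (p01 p)).
have mu1 : \sum_x mu x = 1 by exact: (sum_truncation _ S i0 alpha alpha0 fatS).
pose t := eps ^+ 2 / d%:R.
have t0 : 0 < t by rewrite divr_gt0 ?exprn_gt0 //; lra.
have t1 : t <= 8 by rewrite /t ler_pdivrMr; nra.
pose fail i (s : seq (cube d)) := let f := freq (usable S i) (bit i) s in
  t * (f * (1 - (p i)%:num) + (p i)%:num * (1 - f)) < (f - (p i)%:num) ^+ 2.
have fail_le i : iid_mean mu n (fun s => (fail i s)%:R) <= delta / d%:R.
  pose a := \sum_(x | usable S i x) mu x.
  have alpha_a : alpha <= a.
    by apply: (le_trans (fatS i)); rewrite /Pr (eq_bigl (usable S i)) // => x; rewrite inE.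
  have := deviation_tail mu (usable S i) (bit i) (p i)%:num a t n mu0 mu1
    (erefl _) (truncation_flip_bernoulli _ S i) (p01 p i).
  rewrite t0 t1 => /(_ isT)/le_trans; apply.
  have dd : 0 < d%:R / delta by rewrite divr_gt0 //; lra.
  rewrite -[leRHS]invf_div.
  apply: le_trans (failure_exponent _ L dd (erefl _)).
  rewrite ler_pM2l // ler_expR lerN2.
  (* [32 = 4 * 8] collects the constants of [deviation_tail], and [96 = 3 * 32] brings the exponent
     to [3 * L]. *)
  have -> : 3 * L = X * (alpha * t / 32).
    by rewrite /X /t; field; rewrite !lt0r_neq0 //; lra.
  have -> : n%:R * a / 4 * t / 8 = n%:R * (a * t / 32) by field.
  apply: ler_pM; [lra| |exact: ltW|].
    by rewrite divr_ge0 // mulr_ge0 // ltW.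
  by rewrite ler_pM2r // ler_pM2r.
rewrite success_prob_learner.
(* Union bound taken pointwise: the success indicator is at least 1 minus the number of failing
   coordinates. *)
apply: (@le_trans _ _ (iid_mean mu n (fun s => 1 + (-1) * \sum_i (fail i s)%:R))).
  rewrite iid_meanD iid_meanZ iid_mean_cst // iid_mean_sum mulN1r lerD2l lerN2.
  apply: (@le_trans _ _ (\sum_(i < d) delta / d%:R)); first exact: ler_sum.
  by rewrite sumr_const card_ord -[leLHS]mulr_natr divfK //; lra.
apply: ler_iid_mean => // s _; rewrite mulN1r.
have [/existsP[i fi]|/existsPn nofail] := boolP [exists i, fail i s].
  rewrite (bigD1 i) //= fi; apply: (@le_trans _ _ 0); last exact: ler0n.
  by rewrite opprD addNKr oppr_le0 sumr_ge0.
rewrite big1 => [|i _]; last by rewrite (negPf (nofail i)).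
rewrite subr0 dTV_product_pmf_le // ?eps0 ?(ltW eps1) // => i.
by rewrite ratr_estimate leNgt; exact: nofail.
Qed.
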